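(* In the setting described in the context, suppose the gapless condition (C) holds for every $v\in V$, and let $x^1,\dots,x^N$ be a non-excessive route. Then: (i) any rotation occurs in this route at most once; and (ii) $N<4|E|^2|F||W|$.
   Context: Let $G=(V,E)$ be a finite bipartite graph with color classes $W$ and $F$; the edge joining $w\in W$ and $f\in F$ is written $wf$. Let $b\in\mathbb Z_+^E$ be capacities. For $v\in V$, $E_v$ is the set of edges at $v$, $\mathcal B_v=\{z\in\mathbb Z_+^{E_v}: z\le b|_{E_v}\}$, $\mathbf 1^e$ the unit vector of $e$, $|z|=\sum_e|z(e)|$, $\wedge,\vee$ componentwise min/max. Each $v$ has a choice function $C_v:\mathcal B_v\to\mathcal B_v$ with $C_v(z)\le z$ and, for all $z,z'$: (A1) $z\ge z'\ge C_v(z)\Rightarrow C_v(z')=C_v(z)$; (A2) $z\ge z'\Rightarrow C_v(z)\wedge z'\le C_v(z')$; (A3) $z\ge z'\Rightarrow|C_v(z)|\ge|C_v(z')|$. $z$ is acceptable if $C_v(z)=z$; for distinct acceptable $z,z'$, $z'\prec_v z$ iff $C_v(z\vee z')=z$. $x_v$ = restriction of $x$ to $E_v$. A g-matching is $x\in\mathbb Z_+^E$, $x\le b$, each $x_v$ acceptable; $x\prec_F y$ (distinct) iff $x_f\preceq_f y_f$ for all $f\in F$. $e\in E_v$ is interesting for $v$ under acceptable $z$ if some $z'\in\mathcal B_v$ has $z'(e)>z(e)$, $z'(e')=z(e')$ for $e'\neq e$, $C_v(z')(e)>z(e)$; $e=wf$ blocks a g-matching $x$ if it is interesting for $w$ under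 $x_w$ and for $f$ under $x_f$; $\mathcal S$ = stable g-matchings (no blocking edges), a nonempty finite distributive lattice under $\prec_F$ with minimum $x^{\min}$, maximum $x^{\max}$. Rotations: for $x\in\mathcal S$, $U_F^+(x)$ = edges $wf$ interesting for $f$ under $x_f$; $U_F^-(x)$ = edges $wf$ with $x(wf)>0$ not interesting for $f$ under $x_f$. Legal $f$-pair: $(a,c)$, $a\in U_F^+(x)\cap E_f$, $c\in E_f\setminus\{a\}$, $C_f(x_f+\mathbf 1^a)=x_f+\mathbf 1^a-\mathbf 1^c$. Legal $w$-pair: $(c,a)$, $c\in U_F^-(x)\cap E_w$, $a\in U_F^+(x)\cap E_w$, $x_w+\mathbf 1^a-\mathbf 1^c$ acceptable; essential if no $d\in (U_F^+(x)\cap E_w)\setminus\{a\}$ is interesting for $w$ under $x_w+\mathbf 1^a-\mathbf 1^c$. Form a digraph with vertices $w^e,f^e$ for $e=wf\in U_F^+(x)\cup U_F^-(x)$ and arcs $(w^a,f^a)$ for $a\in U_F^+(x)$, $(f^c,w^c)$ for $c\in U_F^-(x)$, $(f^a,f^c)$ for legal $f$-pairs $(a,c)$, $(w^c,w^a)$ for essential $w$-pairs $(c,a)$; repeatedly delete vertices with no entering arc; each remaining directed cycle gives a cyclic sequence $(a_1,c_1,\dots,a_k,c_k)$ of distinct edges of $G$, a rotation $R$ applicable to $x$ ($R\in\mathcal R(x)$), with $\chi^R$ equal to $1$ on the $a_i$, $-1$ on the $c_i$, $0$ otherwise. Two rotations are the same if they are the same cyclic edge sequence. For $R\in\mathcal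 R(x)$, $\lambda\in\mathbb Z_{>0}$ is a feasible weight if $x+i\chi^R\in\mathcal S$ for $i=1,\dots,\lambda$; $\tau_R(x)$ is the maximum feasible weight. A route is a sequence $x^1,\dots,x^N$ of stable g-matchings with $x^{i+1}=x^i+\lambda_i\chi^{R_i}$, $R_i\in\mathcal R(x^i)$, $\lambda_i$ feasible for $R_i$ at $x^i$; it is non-excessive if $i<j$ and $R_i=R_j$ imply $\lambda_i=\tau_{R_i}(x^i)$. Gapless condition (C) for $v\in V$: if acceptable $z^1,z^2,z^3\in\mathcal B_v$ and edges $a,c^1,c^2,c^3\in E_v$ satisfy (i) $z^1\prec_v z^2\prec_v z^3$, (ii) $C_v(z^i+\mathbf 1^a)=z^i+\mathbf 1^a-\mathbf 1^{c^i}$ for $i=1,2,3$, and (iii) $c^1=c^3$, then $c^1=c^2$.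
   Formalization: The graph is assumed to have at least one edge: if E is empty, the one-term route (N=1) of the zero g-matching would violate the bound N<4|E|²|F||W|, which then reads 1<0. *)

(* Defs.v *)
From HB Require Import structures.
From mathcomp Require Import all_boot all_order all_algebra.
Set Implicit Arguments. Unset Strict Implicit. Unset Printing Implicit Defensive.
Import Order.TTheory GRing.Theory Num.Theory.

(* Bipartite graph: colour classes W, F; edge set E; edge e joins ew e and ef e.
   Vertices V = W + F.  Vectors in Z_+^E are {ffun E -> nat}; a vector
   "in Z_+^{E_v}" is a vector of Z_+^E vanishing outside E_v. *)

Section GMatch.
Variables (W F E : finType) (ew : E -> W) (ef : E -> F).
Variable b : E -> nat.
Variable C : (W + F)%type -> {ffun E -> nat} -> {ffun E -> nat}.

Definition incident (v : W + F) (e : E) : bool :=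
  match v with inl w => ew e == w | inr f => ef e == f end.

Definition inB (v : W + F) (z : {ffun E -> nat}) : Prop :=
  forall e, z e <= (if incident v e then b e else 0).

Definition vle (z z' : {ffun E -> nat}) : Prop := forall e, z e <= z' e.
Definition vmin (z z' : {ffun E -> nat}) : {ffun E -> nat} :=
  [ffun e => minn (z e) (z' e)].
Definition vmax (z z' : {ffun E -> nat}) : {ffun E -> nat} :=
  [ffun e => maxn (z e) (z' e)].
Definition vnorm (z : {ffun E -> nat}) : nat := \sum_(e : E) z e.

Definition restr (v : W + F) (x : {ffun E -> nat}) : {ffun E -> nat} :=
  [ffun e => if incident v e then x e else 0].

Definition addunit (z : {ffun E -> nat}) (a : E) : {ffun E -> nat} :=
  [ffun e => z e + (e == a)].

Definition int_eq (y : {ffun E -> nat}) (g : E -> int) : Prop :=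
  forall e, (Posz (y e)) = g e.

Definition plus_minus (z : {ffun E -> nat}) (a c : E) : E -> int :=
  fun e => ((Posz (z e)) + (Posz (e == a)) - (Posz (e == c)))%R.

Definition choice_axioms : Prop :=
  forall v : W + F,
    (forall z, inB v z -> vle (C v z) z) /\
    (forall z z', inB v z -> inB v z' ->
        vle z' z -> vle (C v z) z' -> C v z' = C v z) /\
    (forall z z', inB v z -> inB v z' ->
        vle z' z -> vle (vmin (C v z) z') (C v z')) /\
    (forall z z', inB v z -> inB v z' ->
        vle z' z -> vnorm (C v z') <= vnorm (C v z)).

Definition acceptable (v : W + F) (z : {ffun E -> nat}) : Prop :=
  inB v z /\ C v z = z.

Definition prec (v : W + F) (z' z : {ffun E -> nat}) : Prop :=
  acceptable v z /\ acceptable v z' /\ z <> z' /\ C v (vmax z z') = z.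

Definition gmatching (x : {ffun E -> nat}) : Prop :=
  (forall e, x e <= b e) /\ forall v, acceptable v (restr v x).

Definition interesting (v : W + F) (z : {ffun E -> nat}) (e : E) : Prop :=
  incident v e /\
  exists z', inB v z' /\ z e < z' e /\
    (forall e', e' != e -> z' e' = z e') /\ z e < C v z' e.

Definition blocking (x : {ffun E -> nat}) (e : E) : Prop :=
  interesting (inl (ew e)) (restr (inl (ew e)) x) e /\
  interesting (inr (ef e)) (restr (inr (ef e)) x) e.

Definition stable (x : {ffun E -> nat}) : Prop :=
  gmatching x /\ forall e, ~ blocking x e.

Definition Uplus (x : {ffun E -> nat}) (e : E) : Prop :=
  interesting (inr (ef e)) (restr (inr (ef e)) x) e.
Definition Uminus (x : {ffun E -> nat}) (e : E) : Prop :=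
  0 < x e /\ ~ Uplus x e.

Definition legal_fpair (x : {ffun E -> nat}) (a c : E) : Prop :=
  Uplus x a /\ ef c = ef a /\ c != a /\
  int_eq (C (inr (ef a)) (addunit (restr (inr (ef a)) x) a))
         (plus_minus (restr (inr (ef a)) x) a c).

Definition legal_wpair (x : {ffun E -> nat}) (c a : E) : Prop :=
  Uminus x c /\ Uplus x a /\ ew a = ew c /\
  exists y, int_eq y (plus_minus (restr (inl (ew c)) x) a c) /\
            acceptable (inl (ew c)) y.

Definition essential_wpair (x : {ffun E -> nat}) (c a : E) : Prop :=
  Uminus x c /\ Uplus x a /\ ew a = ew c /\
  exists y, int_eq y (plus_minus (restr (inl (ew c)) x) a c) /\
            acceptable (inl (ew c)) y /\
            forall d, Uplus x d -> ew d = ew c -> d != a ->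
                      ~ interesting (inl (ew c)) y d.

(* digraph vertices: (true, e) = w^e, (false, e) = f^e *)
Definition dvertex (x : {ffun E -> nat}) (u : bool * E) : Prop :=
  Uplus x u.2 \/ Uminus x u.2.

Definition darc (x : {ffun E -> nat}) (u u' : bool * E) : Prop :=
  dvertex x u /\ dvertex x u' /\
  match u, u' with
  | (true, a), (false, a') => a = a' /\ Uplus x a
  | (false, c), (true, c') => c = c' /\ Uminus x c
  | (false, a), (false, c) => legal_fpair x a c
  | (true, c), (true, a) => essential_wpair x c a
  end.

Fixpoint alive (x : {ffun E -> nat}) (n : nat) (u : bool * E) : Prop :=
  match n with
  | 0 => dvertex x u
  | n'.+1 => alive x n' u /\ exists u', alive x n' u' /\ darc x u' u
  end.

Definition remaining (x : {ffun E -> nat}) (u : bool * E) : Prop :=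
  forall n, alive x n u.

(* A rotation is represented by the list of pairs [:: (a1,c1); ...; (ak,ck)];
   its vertex cycle is w^a1 f^a1 f^c1 w^c1 w^a2 ... w^ck. *)
Definition rot_vertices (R : seq (E * E)) : seq (bool * E) :=
  flatten [seq [:: (true, p.1); (false, p.1); (false, p.2); (true, p.2)] | p <- R].

Definition rot_edges (R : seq (E * E)) : seq E :=
  flatten [seq [:: p.1; p.2] | p <- R].

Definition applicable (x : {ffun E -> nat}) (R : seq (E * E)) : Prop :=
  R <> [::] /\ uniq (rot_vertices R) /\ uniq (rot_edges R) /\
  (forall u, u \in rot_vertices R -> remaining x u) /\
  (forall u u', (u, u') \in zip (rot_vertices R) (rot 1 (rot_vertices R)) ->
                darc x u u').

Definition chi (R : seq (E * E)) (e : E) : int :=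
  ((Posz (e \in [seq p.1 | p <- R])) - (Posz (e \in [seq p.2 | p <- R])))%R.

Definition shift (x : {ffun E -> nat}) (lam : nat) (R : seq (E * E)) : E -> int :=
  fun e => ((Posz (x e)) + lam%:Z * chi R e)%R.

Definition feasible (x : {ffun E -> nat}) (R : seq (E * E)) (lam : nat) : Prop :=
  0 < lam /\
  forall i, 1 <= i <= lam -> exists y, int_eq y (shift x i R) /\ stable y.

Definition is_tau (x : {ffun E -> nat}) (R : seq (E * E)) (t : nat) : Prop :=
  feasible x R t /\ forall m, feasible x R m -> m <= t.

Definition same_rot (R R' : seq (E * E)) : Prop := exists n, rot n R = R'.

(* route x^1..x^N indexed 0..N-1; step i (i+1 < N) uses R_i, lam_i *)
Definition route (N : nat) (xs : nat -> {ffun E -> nat})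
  (Rs : nat -> seq (E * E)) (lams : nat -> nat) : Prop :=
  (forall i, i < N -> stable (xs i)) /\
  forall i, i.+1 < N ->
    applicable (xs i) (Rs i) /\ feasible (xs i) (Rs i) (lams i) /\
    int_eq (xs i.+1) (shift (xs i) (lams i) (Rs i)).

Definition non_excessive (N : nat) (xs : nat -> {ffun E -> nat})
  (Rs : nat -> seq (E * E)) (lams : nat -> nat) : Prop :=
  forall i j, i < j -> j.+1 < N -> same_rot (Rs i) (Rs j) ->
    is_tau (xs i) (Rs i) (lams i).

Definition gapless (v : W + F) : Prop :=
  forall (z1 z2 z3 : {ffun E -> nat}) (a c1 c2 c3 : E),
    acceptable v z1 -> acceptable v z2 -> acceptable v z3 ->
    incident v a -> incident v c1 -> incident v c2 -> incident v c3 ->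
    prec v z1 z2 -> prec v z2 z3 ->
    inB v (addunit z1 a) -> int_eq (C v (addunit z1 a)) (plus_minus z1 a c1) ->
    inB v (addunit z2 a) -> int_eq (C v (addunit z2 a)) (plus_minus z2 a c2) ->
    inB v (addunit z3 a) -> int_eq (C v (addunit z3 a)) (plus_minus z3 a c3) ->
    c1 = c3 -> c1 = c2.

End GMatch.

(* Main.v *)
Require Import Defs.
From mathcomp Require Import all_boot all_order all_algebra.
From mathcomp Require Import boolp zify.
Set Implicit Arguments. Unset Strict Implicit. Unset Printing Implicit Defensive.

(* Along a route, W gets worse off (edges raised by a rotation are, by stability, not
   interesting for W), hence F gets better off.  An exchange "a in, c out" at f, and an
   essential pair at w read backwards as the exchange "c in, a out", are both of the kind
   governed by the gapless condition.  So each arc of the rotation digraph is present on an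
   interval of times of the route.

   A cycle R of arcs present at x always makes x + chi R stable.  If R is used at times
   i < j, its arcs are present at time i + 1, so the weight at time i could be increased,
   against its maximality.

   Among the arcs of R_j, let p_j be the one that appears last.  The arcs leaving a vertex
   at a given time are unique, so p_i = p_j with i < j would force R_j to be a cycle
   present at time i through an arc of R_i, that is, R_i = R_j.  Hence j |-> p_j is
   injective, and there are at most |E||W| + |E||F| arcs. *)

(** * Nonnegative integer vectors, unit steps and sizes *)

Section Vectors.
Variable E : finType.
Implicit Types (x y z u t : {ffun E -> nat}) (a c d e : E).

(** Subtraction is truncated: this is z - 1^c only when [0 < z c]. *)
Definition subunit z c : {ffun E -> nat} := [ffun e => z e - (e == c)].

Definition swap z a c := addunit (subunit z c) a.

Lemma vle_trans y x z : vle x y -> vle y z -> vle x z.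
Proof. by move=> xy yz e; apply: leq_trans (yz e). Qed.

Lemma vle_maxl x y : vle x (vmax x y).
Proof. by move=> e; rewrite ffunE leq_maxl. Qed.

Lemma vle_maxr x y : vle y (vmax x y).
Proof. by move=> e; rewrite ffunE leq_maxr. Qed.

Lemma vmax_le x y u : vle x u -> vle y u -> vle (vmax x y) u.
Proof. by move=> xu yu e; rewrite ffunE geq_max xu yu. Qed.

Lemma vmaxC x y : vmax x y = vmax y x.
Proof. by apply/ffunP=> e; rewrite !ffunE maxnC. Qed.

Lemma vmaxxx x : vmax x x = x.
Proof. by apply/ffunP=> e; rewrite !ffunE maxnn. Qed.

Lemma vle_addunit z a : vle z (addunit z a).
Proof. by move=> e; rewrite ffunE leq_addr. Qed.

Lemma subunit_le z c : vle (subunit z c) z.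
Proof. by move=> e; rewrite ffunE leq_subr. Qed.

Lemma addunit_subunit z c : 0 < z c -> addunit (subunit z c) c = z.
Proof.
move=> zc; apply/ffunP=> e; rewrite !ffunE; case: eqP => [->|_]; lia.
Qed.

Lemma addunit_inj z : injective (addunit z).
Proof. by move=> a c /ffunP/(_ a); rewrite !ffunE eqxx; case: eqP => //; lia. Qed.

Lemma vle_anti y z : vle y z -> vle z y -> y = z.
Proof. by move=> yz zy; apply/ffunP=> e; apply/eqP; rewrite eqn_leq yz zy. Qed.

Lemma vnorm_le y z : vle y z -> vnorm y <= vnorm z.
Proof. by move=> yz; apply: leq_sum => e _; apply: yz. Qed.

Lemma vnorm_addunit z a : vnorm (addunit z a) = (vnorm z).+1.
Proof.
rewrite /vnorm (eq_bigr (fun e => z e + (e == a))); last by move=> e _; rewrite ffunE.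
have Ea : \sum_e nat_of_bool (e == a) = 1.
  by rewrite (bigD1 a) //= eqxx big1 // => e /negbTE->.
by rewrite big_split /= Ea addn1.
Qed.

Lemma vnorm_swap z a c : 0 < z c -> vnorm (swap z a c) = vnorm z.
Proof. by move=> zc; rewrite vnorm_addunit -(vnorm_addunit _ c) addunit_subunit. Qed.

Lemma vle_norm_eq y z : vle y z -> vnorm z <= vnorm y -> y = z.
Proof.
move=> yz zy; apply: vle_anti => // e; rewrite leqNgt; apply/negP => lt_e.
have : vle (addunit y e) z.
  by move=> e'; rewrite ffunE; case: eqP => [->|_]; rewrite ?addn1 ?addn0.
by move/vnorm_le; rewrite vnorm_addunit; lia.
Qed.

Lemma vle_norm_succ y z :
  vle y z -> vnorm z = (vnorm y).+1 -> exists c, z = addunit y c.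
Proof.
move=> yz nz.
have [c lt_c] : exists c, y c < z c.
  apply: contrapT => no_c; suff : y = z by move=> yz_eq; rewrite yz_eq in nz; lia.
  by apply: vle_anti => // e; rewrite leqNgt; apply/negP => ?; apply: no_c; exists e.
exists c; apply/esym/vle_norm_eq; last by rewrite vnorm_addunit nz.
by move=> e; rewrite ffunE; case: eqP => [->|_]; rewrite ?addn1 ?addn0.
Qed.

(** Moving the removed unit to the other side leaves an identity of naturals without truncation. *)
Lemma int_eq_plus_minus y z a c :
  int_eq y (plus_minus z a c) <-> addunit y c = addunit z a.
Proof.
split=> [yz|/ffunP yz e].
  by apply/ffunP=> e; have := yz e; rewrite /plus_minus !ffunE; lia.
by have := yz e; rewrite /plus_minus !ffunE; lia.
Qed.

Lemma addunit_eq_swap y z a c :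
  a != c -> addunit y c = addunit z a -> y = swap z a c /\ 0 < z c.
Proof.
move=> ac /ffunP yz; split; last first.
  by have := yz c; rewrite !ffunE eqxx [c == a]eq_sym (negbTE ac); lia.
apply/ffunP=> e; have := yz e; rewrite !ffunE.
by case: (eqVneq e c) => [->|]; rewrite 1?[c == a]eq_sym ?(negbTE ac); lia.
Qed.

Lemma swap_addunit z a c : 0 < z c -> addunit (swap z a c) c = addunit z a.
Proof.
by move=> zc; apply/ffunP=> e; rewrite !ffunE; case: (eqVneq e c) => [->|]; lia.
Qed.

End Vectors.

(** * Choice functions at a single vertex *)

Section ChoiceAtVertex.
Variables (W F E : finType) (ew : E -> W) (ef : E -> F) (b : E -> nat).
Variable C : (W + F)%type -> {ffun E -> nat} -> {ffun E -> nat}.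
Hypothesis HC : choice_axioms ew ef b C.
Variable v : (W + F)%type.

Implicit Types (x y z u t : {ffun E -> nat}) (a c d e : E) (P Q T : pred E).

Local Notation inB := (inB ew ef b v).
Local Notation acceptable := (acceptable ew ef b C v).
Local Notation interesting := (interesting ew ef b C v).
Local Notation Cv := (C v).
Local Notation cap := (fun e => if incident ew ef v e then b e else 0).

Lemma choice_le z : inB z -> vle (Cv z) z.
Proof. by case: (HC v) => + _; apply. Qed.

Lemma choice_consistent z z' : inB z -> vle z' z -> vle (Cv z) z' -> Cv z' = Cv z.
Proof.
case: (HC v) => _ [A1 _] Bz z'z; apply: A1 => // e.
exact: leq_trans (Bz e).
Qed.

Lemma choice_subst z z' e : inB z -> vle z' z -> minn (Cv z e) (z' e) <= Cv z' e.
Proof.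
case: (HC v) => _ [_ [A2 _]] Bz z'z.
have Bz' : inB z' by move=> d; exact: leq_trans (Bz d).
by have := A2 _ _ Bz Bz' z'z e; rewrite ffunE.
Qed.

Lemma choice_mono z z' : inB z -> vle z' z -> vnorm (Cv z') <= vnorm (Cv z).
Proof.
case: (HC v) => _ [_ [_ A3]] Bz z'z; apply: A3 => // e.
exact: leq_trans (Bz e).
Qed.

Lemma inB_le u z : inB u -> vle z u -> inB z.
Proof. by move=> Bu zu e; exact: leq_trans (Bu e). Qed.

Lemma inB_max x y : inB x -> inB y -> inB (vmax x y).
Proof. by move=> Bx By e; rewrite ffunE geq_max Bx By. Qed.

Lemma incident_pos u e : inB u -> 0 < u e -> incident ew ef v e.
Proof. by move=> /(_ e); case: ifP => // _; rewrite leqn0 => /eqP->. Qed.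

Lemma choice_acceptable z : inB z -> acceptable (Cv z).
Proof.
move=> Bz; split; first exact: inB_le (choice_le Bz).
by apply: choice_consistent => //; exact: choice_le.
Qed.

Lemma choice_between u z t : inB u -> Cv u = z -> vle z t -> vle t u -> Cv t = z.
Proof. by move=> Bu uz zt tu; rewrite -uz; apply: choice_consistent => //; rewrite uz. Qed.

(** A witness of interest raises [e] alone. Cutting the other coordinates of [u] back to [z] gives
    one, since (A2) keeps the choice at [e] above [z e]. *)
Lemma interesting_of u z e : inB u -> vle z u -> z e < Cv u e -> interesting z e.
Proof.
move=> Bu zu lt_e.
have ue := choice_le Bu e.
split; first by apply: incident_pos Bu _; lia.
pose t : {ffun E -> nat} := [ffun d => if d == e then u e else z d].
have tu : vle t u by move=> d; rewrite ffunE; case: eqP => [->|].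
exists t; split; first exact: inB_le tu.
split; first by rewrite ffunE eqxx; lia.
split; first by move=> d /negbTE de; rewrite ffunE de.
by have := choice_subst e Bu tu; rewrite ffunE eqxx; lia.
Qed.

(** A coordinate of [Cv u] above [z] would be interesting by [interesting_of]; hence [Cv u] lies
    below [z], and (A1) applies. *)
Lemma absorb_uninteresting z u : acceptable z -> inB u -> vle z u ->
  (forall e, z e < u e -> ~ interesting z e) -> Cv u = z.
Proof.
move=> [_ zz] Bu zu no_int; rewrite -[RHS]zz; apply/esym/choice_consistent => // e.
rewrite leqNgt; apply/negP => lt_e; apply: (no_int e).
  by have := choice_le Bu e; lia.
exact: interesting_of lt_e.
Qed.

(** A better-off vertex is interested in fewer edges. Let [t] witness [e] for [z']. If
    [Cv (vmax z t)] were at most [z e] at [e], (A2) would put it below [z'], and (A1) would make it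
    equal to [Cv t], which exceeds [z'] at [e]. *)
Lemma interesting_antimono z z' e : acceptable z -> acceptable z' ->
  Cv (vmax z z') = z' -> interesting z' e -> interesting z e.
Proof.
move=> [Bz zz] [Bz' zz'] Cmax [_ [t [Bt [lt_e [t_out lt_Ce]]]]].
apply: contrapT => no_int.
have z't : vle z' t.
  by move=> d; case: (eqVneq d e) => [->|/t_out->]; lia.
have Bu := inB_max Bz Bt.
have mle : vle (vmax z z') (vmax z t).
  by move=> d; rewrite !ffunE; have := z't d; lia.
have Ce : Cv (vmax z t) e <= z e.
  rewrite leqNgt; apply/negP => lt; apply: no_int.
  by apply: interesting_of lt => //; exact: vle_maxl.
have Cz' : vle (Cv (vmax z t)) z'.
  move=> d; have := choice_subst d Bu mle; rewrite Cmax.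
  have := choice_le Bu d; rewrite !ffunE.
  by case: (eqVneq d e) => [->|/t_out->]; lia.
have Ct := choice_consistent Bu (vle_maxr z t) (vle_trans Cz' z't).
by have := Cz' e; rewrite -Ct; lia.
Qed.

(** (A2) against [vmax x y] and against [vmax y z] bounds the choice from the join of all three by
    [z]; (A1) then identifies it. *)
Lemma choice_trans x y z : acceptable x -> acceptable y -> acceptable z ->
  Cv (vmax x y) = y -> Cv (vmax y z) = z -> Cv (vmax x z) = z.
Proof.
move=> [Bx _] [By _] [Bz zz] Cxy Cyz.
have Bu := inB_max (inB_max Bx By) Bz.
have Cz : vle (Cv (vmax (vmax x y) z)) z.
  move=> e.
  have xyle : vle (vmax x y) (vmax (vmax x y) z) by apply: vle_maxl.
  have yzle : vle (vmax y z) (vmax (vmax x y) z) by move=> d; rewrite !ffunE; lia.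
  have := choice_subst e Bu xyle; have := choice_subst e Bu yzle.
  by have := choice_le Bu e; rewrite Cxy Cyz !ffunE; lia.
have Cu : Cv (vmax (vmax x y) z) = z.
  by rewrite -{2}zz; apply/esym/choice_consistent => //; exact: vle_maxr.
by apply: choice_between Bu Cu _ _ => [|e]; [exact: vle_maxr | rewrite !ffunE; lia].
Qed.

(** By (A2), the first extra unit of [a] is accepted as soon as a larger raise is accepted in
    part. *)
Lemma interesting_addunit z a : acceptable z -> interesting z a ->
  inB (addunit z a) /\ Cv (addunit z a) a = (z a).+1.
Proof.
move=> [Bz zz] [_ [t [Bt [lt_a [t_out lt_Ca]]]]].
have zt : vle (addunit z a) t.
  by move=> d; rewrite ffunE; case: (eqVneq d a) => [->|/t_out->]; lia.
have Ba := inB_le Bt zt; split => //.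
by have := choice_subst a Bt zt; have := choice_le Ba a; rewrite !ffunE eqxx; lia.
Qed.

(** * The gapless condition at a vertex: exchanges valid at two ends are valid in between *)

Hypothesis Hgap : gapless ew ef b C v.

(* The gapless condition only applies once adding a to y is known to expel an edge. *)
Lemma exchange_convex x y z a c :
  acceptable x -> acceptable y -> acceptable z ->
  vnorm y = vnorm z -> Cv (vmax x y) = y -> Cv (vmax y z) = z ->
  c != a -> incident ew ef v a -> incident ew ef v c ->
  inB (addunit x a) -> addunit (Cv (addunit x a)) c = addunit x a ->
  interesting z a -> addunit (Cv (addunit z a)) c = addunit z a ->
  addunit (Cv (addunit y a)) c = addunit y a.
Proof.
move=> ax ay az nyz Cxy Cyz ca ia ic Bxa Cxa zia Cza.
have [Bza Cza_a] := interesting_addunit az zia.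
have [Bya Cya_a] := interesting_addunit ay (interesting_antimono ay az Cyz zia).
have nza : vnorm (Cv (addunit z a)) = vnorm z.
  by have := congr1 (@vnorm E) Cza; rewrite !vnorm_addunit => -[].
have [Bx xx] := ax; have [By yy] := ay; have [Bz zz] := az.
(* Otherwise [addunit z a] lies between [z] and [vmax y z], so (A1) makes its choice [z], without
   the new unit of [a]. *)
have le_a : y a <= z a.
  rewrite leqNgt; apply/negP => lt_a.
  have : Cv (addunit z a) = z.
    apply: choice_between (inB_max By Bz) Cyz (vle_addunit z a) _ => e.
    by rewrite !ffunE; case: (eqVneq e a) => [->|]; lia.
  by move=> Cz; rewrite Cz in Cza_a; lia.
(* An edge is expelled because sizes agree: the join of the two enlarged vectors has the same choice
   as [addunit z a], of size |z| = |y|, and (A3) bounds the choice from [addunit y a] by it. *)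
have nya : vnorm (Cv (addunit y a)) = vnorm y.
  have Bu := inB_max Bya Bza.
  apply/eqP; rewrite eqn_leq; apply/andP; split; last first.
    by rewrite -{1}yy; apply: choice_mono => //; exact: vle_addunit.
  have mle : vle (vmax y z) (vmax (addunit y a) (addunit z a)).
    by move=> e; rewrite !ffunE; lia.
  have -> : vnorm y = vnorm (Cv (vmax (addunit y a) (addunit z a))).
    rewrite nyz -nza; congr vnorm; apply: choice_consistent => //; first exact: vle_maxr.
    move=> e; have := choice_subst e Bu mle; have := choice_le Bu e.
    by rewrite Cyz !ffunE; case: (eqVneq e a) => [->|]; lia.
  by apply: choice_mono => //; exact: vle_maxl.
have [c2 Ec2] : exists c2, addunit y a = addunit (Cv (addunit y a)) c2.
  by apply: vle_norm_succ; [exact: choice_le | rewrite vnorm_addunit nya].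
(* [prec] is strict, so coincidences with [x] or [z] are settled first. *)
have [eyx|nyx] := eqVneq y x; first by rewrite eyx.
have [eyz|nyz'] := eqVneq y z; first by rewrite eyz.
have ic2 : incident ew ef v c2.
  by apply: incident_pos Bya _; rewrite Ec2 ffunE eqxx addn1.
rewrite (Hgap ax ay az ia ic ic2 ic _ _ Bxa _ Bya _ Bza _ (erefl c)) //;
  try exact/int_eq_plus_minus.
- by split=> //; split=> //; split; [exact/eqP | rewrite vmaxC].
- by split=> //; split=> //; split; [move=> ezy; rewrite ezy eqxx in nyz' | rewrite vmaxC].
Qed.

(** The offer made to [v] when the edges in [P] are those the other side still wants; [P] is later
    [UP x]. *)
Definition top x P : {ffun E -> nat} := [ffun e => if P e then cap e else x e].

Lemma inB_top x P : inB x -> inB (top x P).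
Proof. by move=> Bx e; rewrite ffunE; case: ifP. Qed.

Lemma vle_top x P : inB x -> vle x (top x P).
Proof. by move=> Bx e; rewrite ffunE; case: ifP. Qed.

Lemma choice_top x P : acceptable x -> (forall e, P e -> ~ interesting x e) ->
  Cv (top x P) = x.
Proof.
move=> ax noP; have [Bx _] := ax.
apply: absorb_uninteresting => //; [exact: inB_top | exact: vle_top |].
by move=> e; rewrite ffunE; case: ifP => [Pe _|_]; [exact: noP | rewrite ltnn].
Qed.

Lemma swap_le_top x P a c : inB x -> ~~ P c -> P a -> x a < cap a ->
  vle (swap x a c) (subunit (top x P) c).
Proof.
move=> Bx Pc Pa xa e; rewrite !ffunE; have := Bx e.
case: (eqVneq e a) => [->|_]; last by case: (P e); lia.
by case: (eqVneq a c) => [ac|_]; [rewrite -ac Pa in Pc | rewrite Pa; lia].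
Qed.

(* For P the edges still interesting for the other side, essential pairs (c, a)
   are exactly those where lowering c makes v pick up a, given free access to P. *)
Lemma choice_top_swapP x P a c : acceptable x -> (forall e, P e -> ~ interesting x e) ->
  P a -> ~~ P c -> 0 < x c ->
  (Cv (subunit (top x P) c) = swap x a c <->
   acceptable (swap x a c) /\
   forall d, P d -> d != a -> ~ interesting (swap x a c) d).
Proof.
move=> ax noP Pa Pc xc; have [Bx xx] := ax.
have Bt := inB_top P Bx.
have Bs := inB_le Bt (subunit_le (top x P) c).
have ac : a != c by apply: contraNneq Pc => <-.
split=> [Cs|[as_ no_d]].
  split; first by rewrite -Cs; exact: choice_acceptable.
  move=> d Pd da [_ [t [tB [lt_d [t_out]]]]].
  rewrite (choice_between Bs Cs) ?ltnn // => e.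
    by case: (eqVneq e d) => [->|/t_out->]; lia.
  case: (eqVneq e d) => [->|/t_out->]; last by rewrite -Cs; exact: choice_le.
  have dc : d != c by apply: contraNneq Pc => <-.
  by rewrite !ffunE Pd (negbTE dc) subn0.
apply: absorb_uninteresting => //.
  apply: swap_le_top => //; case: as_ => /(_ a) + _.
  by rewrite !ffunE eqxx (negbTE ac); lia.
move=> e lt_e; have Pe : P e.
  apply: contraLR lt_e => Pe; rewrite -leqNgt !ffunE (negbTE Pe); lia.
have [ea|] := eqVneq e a; last exact: no_d.
(* The hypothesis leaves out [a] itself, which is excluded by counting: [Cv t] would contain
   [swap x a c] and one more unit of [a], exceeding the size of [x] against (A3). *)
rewrite {e lt_e Pe}ea => -[_ [t [tB [lt_a [t_out lt_Ca]]]]].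
have tt : vle t (top x P).
  move=> e; case: (eqVneq e a) => [->|ea]; first by rewrite ffunE Pa; exact: tB.
  by have := Bx e; rewrite t_out // !ffunE (negbTE ea); case: (P e); lia.
have := choice_mono Bt tt; rewrite (choice_top ax noP).
suff /vnorm_le : vle (addunit (swap x a c) a) (Cv t).
  by rewrite vnorm_addunit vnorm_swap //; lia.
move=> e; have := choice_subst e Bt tt; rewrite (choice_top ax noP).
case: (eqVneq e a) => [->|ea]; first by rewrite [addunit _ _ _]ffunE eqxx; lia.
by rewrite t_out // !ffunE (negbTE ea); lia.
Qed.

(* Here x is best and z worst for v.  The exchange fed to the gapless condition is
   the reverse one, "c in, a out", at the three vectors after the swap. *)
Lemma essential_convex x y z P Q T a c :
  acceptable x -> acceptable y -> acceptable z ->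
  vnorm y = vnorm z -> incident ew ef v a -> incident ew ef v c ->
  (forall e, P e -> ~ interesting x e) -> (forall e, Q e -> ~ interesting y e) ->
  (forall e, T e -> ~ interesting z e) ->
  subpred Q P -> subpred T Q ->
  (forall e, x e < y e -> P e) -> (forall e, y e < z e -> Q e) ->
  ~~ P c -> T a -> 0 < z c ->
  Cv (subunit (top x P) c) = swap x a c -> Cv (subunit (top z T) c) = swap z a c ->
  Cv (subunit (top y Q) c) = swap y a c.
Proof.
move=> ax ay az nyz ia ic noP noQ noT QP TQ xyP yzQ Pc Ta zc Cx Cz.
have [Bx _] := ax; have [By _] := ay; have [Bz _] := az.
have Qc : ~~ Q c by apply: contra Pc; apply: QP.
have Tc : ~~ T c by apply: contra Qc; apply: TQ.
have yc : z c <= y c by rewrite leqNgt; apply: contra Qc; apply: yzQ.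
have xc : y c <= x c by rewrite leqNgt; apply: contra Pc; apply: xyP.
have y0 : 0 < y c := leq_trans zc yc.
have x0 : 0 < x c := leq_trans y0 xc.
have ac : a != c by apply: contraNneq Tc => <-.
have Bsx : inB (subunit (top x P) c) := inB_le (inB_top P Bx) (subunit_le _ c).
have Bsy : inB (subunit (top y Q) c) := inB_le (inB_top Q By) (subunit_le _ c).
have Bsz : inB (subunit (top z T) c) := inB_le (inB_top T Bz) (subunit_le _ c).
have swB u e P' : inB u -> Cv (subunit (top u P') c) = swap u a c -> swap u a c e <= cap e.
  move=> Bu Cu; rewrite -Cu; apply: (choice_acceptable _).1.
  exact: inB_le (inB_top P' Bu) (subunit_le _ c).
(* What [v] holds after the swap at [z] is also on offer at [y], because [z] exceeds [y] only on
   [Q]. *)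
have zy : vle (swap z a c) (subunit (top y Q) c).
  move=> e; have := swB z e T Bz Cz; have := Bz e; have := yzQ e.
  rewrite !ffunE; case: (boolP (Q e)) => [Qe|nQe] yzQe.
    by have /negbTE-> : e != c by [apply: contraNneq Qc => <-]; rewrite !subn0.
  have /negbTE-> : e != a by apply: contraNneq nQe => ->; exact: TQ.
  by rewrite addn0 => _ _; apply: leq_sub2r; rewrite leqNgt; apply/negP => /yzQe.
(* Exactly one unit replaces [c]: (A2) retains [subunit y c], and (A3) fixes the size, from above
   through [top y Q] and from below through [zy]. *)
have [d Ed] : exists d, Cv (subunit (top y Q) c) = addunit (subunit y c) d.
  apply: vle_norm_succ.
    move=> e; have := choice_subst e (inB_top Q By) (subunit_le (top y Q) c).
    rewrite (choice_top ay noQ); apply: leq_trans; rewrite leq_min subunit_le /=.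
    by have := vle_top Q By e; rewrite !ffunE => le_e; apply: leq_sub2r.
  rewrite -(vnorm_addunit (subunit y c) c) addunit_subunit //.
  apply/eqP; rewrite eqn_leq; apply/andP; split.
    rewrite -[in X in _ <= X](choice_top ay noQ).
    by apply: choice_mono; [exact: inB_top | exact: subunit_le].
  rewrite nyz -(vnorm_swap a zc) -[X in vnorm X <= _]Cz -(choice_acceptable Bsz).2 Cz.
  exact: choice_mono.
rewrite -/(swap y d c) in Ed.
suff -> : a = d by [].
have Qd : Q d.
  have := choice_le Bsy d; rewrite Ed !ffunE eqxx.
  by case: ifP => // _; rewrite addn1 ltnn.
have dc : d != c by apply: contraNneq Qc => <-.
have id' : incident ew ef v d.
  by apply: incident_pos (choice_acceptable Bsy).1 _; rewrite Ed !ffunE eqxx addn1.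
(* Returning [c] to the swap gives [addunit u g], which lies between [u] and [top u P']. The choice
   is therefore [u]: [c] enters and [g] leaves. *)
have exch u P' g : acceptable u -> (forall e, P' e -> ~ interesting u e) ->
    P' g -> 0 < u c -> g != c ->
    Cv (subunit (top u P') c) = swap u g c ->
    inB (addunit (swap u g c) c) /\
    addunit (Cv (addunit (swap u g c) c)) g = addunit (swap u g c) c.
  move=> au noP' P'g uc gc Cu; have [Bu _] := au.
  have le_t : vle (addunit u g) (top u P').
    move=> e; rewrite [addunit _ _ e]ffunE.
    case: (eqVneq e g) => [->|_]; last by rewrite addn0; exact: vle_top.
    have := (choice_acceptable (inB_le (inB_top P' Bu) (subunit_le _ c))).1 g.
    by rewrite Cu !ffunE eqxx (negbTE gc) P'g subn0.
  rewrite swap_addunit //; split; first exact: inB_le (inB_top P' Bu) le_t.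
  by rewrite (choice_between (inB_top P' Bu) (choice_top au noP') (vle_addunit u g) le_t).
have [Bx' Ex'] := exch x P a ax noP (QP _ (TQ _ Ta)) x0 ac Cx.
have [By' Ey'] := exch y Q d ay noQ Qd y0 dc Ed.
have [Bz' Ez'] := exch z T a az noT Ta zc ac Cz.
have [eyx|nyx] := eqVneq (swap y d c) (swap x a c).
  by rewrite eyx in Ey'; exact: addunit_inj (etrans Ex' (esym Ey')).
have [eyz|nyz'] := eqVneq (swap y d c) (swap z a c).
  by rewrite eyz in Ey'; exact: addunit_inj (etrans Ez' (esym Ey')).
have asx : acceptable (swap x a c) by rewrite -Cx; exact: choice_acceptable.
have asy : acceptable (swap y d c) by rewrite -Ed; exact: choice_acceptable.
have asz : acceptable (swap z a c) by rewrite -Cz; exact: choice_acceptable.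
(* The swaps at [z], [y], [x] increase in the preference of [v]; on entry of [c] they expel [a],
   [d], [a]. *)
apply: (Hgap asz asy asx ic ia id' ia _ _ Bz' _ By' _ Bx' _ (erefl a));
  try exact/int_eq_plus_minus.
- split=> //; split=> //; split; first exact/eqP.
  apply: (choice_between Bsy Ed (vle_maxl _ _)); apply: vmax_le zy.
  by rewrite -Ed; exact: choice_le.
- split=> //; split=> //; split; first by move=> exy; rewrite exy eqxx in nyx.
  apply: (choice_between Bsx Cx (vle_maxl _ _)); apply: vmax_le.
    by rewrite -Cx; exact: choice_le.
  apply: vle_trans (_ : vle (subunit (top y Q) c) _); first by rewrite -Ed; exact: choice_le.
  move=> e; rewrite !ffunE; apply: leq_sub2r.
  case: (boolP (P e)) => [Pe|nPe]; first by case: (Q e); [exact: leqnn | exact: By].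
  have /negbTE-> : ~~ Q e by apply: contra nPe; apply: QP.
  by rewrite leqNgt; apply: contra nPe; apply: xyP.
Qed.

End ChoiceAtVertex.

(** * Cyclic sequences and cycles of a functional relation *)

Section CyclicSequences.
Variable T : eqType.
Implicit Types (s t : seq T) (p q : T).

Definition arcs s := zip s (rot 1 s).

Lemma zip_rot n s t : size s = size t -> zip (rot n s) (rot n t) = rot n (zip s t).
Proof.
move=> st; rewrite /rot zip_cat ?size_drop ?st //; congr cat.
  by elim: s t n st => [|x s IHs] [|y t] [|n] //= [st]; rewrite IHs.
by elim: s t n st => [|x s IHs] [|y t] [|n] //= [st]; rewrite IHs.
Qed.

Lemma mem_arcs_rot n s : arcs (rot n s) =i arcs s.
Proof. by move=> p; rewrite /arcs rot_rot zip_rot ?size_rot // mem_rot. Qed.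

Lemma unzip1_arcs s : unzip1 (arcs s) = s.
Proof. by rewrite unzip1_zip ?size_rot. Qed.

Lemma unzip2_arcs s : unzip2 (arcs s) = rot 1 s.
Proof. by rewrite unzip2_zip ?size_rot. Qed.

Lemma arcs_mem s p q : (p, q) \in arcs s -> (p \in s) && (q \in s).
Proof.
move=> pq; apply/andP; split.
  by rewrite -(unzip1_arcs s); apply/mapP; exists (p, q).
by rewrite -(mem_rot 1) -(unzip2_arcs s); apply/mapP; exists (p, q).
Qed.

Lemma arcs_pred s q : q \in s -> exists p, (p, q) \in arcs s.
Proof.
by rewrite -(mem_rot 1) -(unzip2_arcs s) => /mapP[[p q'] pq /= ->]; exists p.
Qed.

Lemma arcs_succ s p : p \in s -> exists q, (p, q) \in arcs s.
Proof. by rewrite -{1}(unzip1_arcs s) => /mapP[[p' q] pq /= ->]; exists q. Qed.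

(** Functionality fixes the two paths step by step. As [q] is interior to neither, they reach it
    simultaneously. *)
Lemma path_functional (r : T -> T -> Prop) p s t q :
  (forall x y z, r x y -> r x z -> y = z) -> q \notin s -> q \notin t ->
  (forall x y, (x, y) \in zip (p :: s) (rcons s q) -> r x y) ->
  (forall x y, (x, y) \in zip (p :: t) (rcons t q) -> r x y) -> s = t.
Proof.
move=> fun_r; elim: s p t => [|x s IHs] p [|y t] //= qs qt rs rt.
- have pq := rs _ _ (mem_head _ _); have py := rt _ _ (mem_head _ _).
  by rewrite (fun_r _ _ _ py pq) mem_head in qt.
- have pq := rt _ _ (mem_head _ _); have px := rs _ _ (mem_head _ _).
  by rewrite (fun_r _ _ _ px pq) mem_head in qs.
have px := rs _ _ (mem_head _ _); have py := rt _ _ (mem_head _ _).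
rewrite (fun_r _ _ _ px py) in rs qs *; move: qs qt; rewrite !inE !negb_or.
case/andP=> _ qs /andP[_ qt]; congr cons; apply: (IHs y) => // u u' uu'.
  by apply: rs; rewrite inE uu' orbT.
by apply: rt; rewrite inE uu' orbT.
Qed.

(** Both cycles are turned to start at the common [p] and compared as paths from [p] back to [p];
    [uniq] keeps [p] out of their interiors. *)
Lemma cycle_functional (r : T -> T -> Prop) s t p :
  (forall x y z, r x y -> r x z -> y = z) -> uniq s -> uniq t ->
  (forall x y, (x, y) \in arcs s -> r x y) -> (forall x y, (x, y) \in arcs t -> r x y) ->
  p \in s -> p \in t -> exists n, rot n s = t.
Proof.
move=> fun_r us ut rs rt /rot_to[i s' Es] /rot_to[j t' Et].
have /andP[ps' _] : uniq (p :: s') by rewrite -Es rot_uniq.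
have /andP[pt' _] : uniq (p :: t') by rewrite -Et rot_uniq.
have st : s' = t'.
  apply: (@path_functional r p _ _ p) => // x y xy; [apply: rs | apply: rt].
    by rewrite -(mem_arcs_rot i) Es /arcs rot1_cons.
  by rewrite -(mem_arcs_rot j) Et /arcs rot1_cons.
have -> : t = rotr j (rot i s) by rewrite Es st -Et rotK.
by eexists; rewrite /rotr rot_rot_add.
Qed.

End CyclicSequences.

(** * Rotations as lists of pairs *)

Section RotationLists.
Variable E : finType.
Implicit Types (R : seq (E * E)) (p q : E * E).

(** Each pair contributes four vertices, so the cyclic arcs are three inside each pair and one
    leading to the next pair. *)
Lemma rot_vertices_arcs (D : bool * E -> bool * E -> Prop) R :
  (forall u u', (u, u') \in arcs (rot_vertices R) -> D u u') ->
  (forall p, p \in R -> [/\ D (true, p.1) (false, p.1), D (false, p.1) (false, p.2)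
                          & D (false, p.2) (true, p.2)]) /\
  (forall p q, (p, q) \in arcs R -> D (true, p.2) (true, q.1)).
Proof.
case: R => [|p R] //.
(* Closing the path at an arbitrary [q] instead of the first pair makes induction on the list
   possible. *)
suff gen q : (forall u u', (u, u') \in zip (rot_vertices (p :: R))
      (rcons (behead (rot_vertices (p :: R))) (true, q.1)) -> D u u') ->
    (forall p0, p0 \in p :: R -> [/\ D (true, p0.1) (false, p0.1),
       D (false, p0.1) (false, p0.2) & D (false, p0.2) (true, p0.2)]) /\
    (forall p0 q0, (p0, q0) \in zip (p :: R) (rcons R q) -> D (true, p0.2) (true, q0.1)).
  move=> D_; rewrite /arcs rot1_cons; apply: gen => u u' uu'.
  by apply: D_; rewrite /arcs rot1_cons.
elim: R p => [|p' R IHR] p D_.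
  split=> [p0|p0 q0]; rewrite !inE.
    by move/eqP->; split; apply: D_; rewrite /= !in_cons eqxx ?orbT.
  by rewrite xpair_eqE => /andP[/eqP-> /eqP->]; apply: D_; rewrite /= !in_cons eqxx ?orbT.
have [|D1 D2] := IHR p'.
  by move=> u u' uu'; apply: D_; rewrite /= !in_cons in uu' *; rewrite uu' !orbT.
split=> [p0|p0 q0]; rewrite inE => /orP[|]; [move/eqP->|exact: D1| |exact: D2].
  by split; apply: D_; rewrite /= !in_cons eqxx ?orbT.
by rewrite xpair_eqE => /andP[/eqP-> /eqP->]; apply: D_; rewrite /= !in_cons eqxx ?orbT.
Qed.

Lemma perm_rot_edges R :
  perm_eq (rot_edges R) ([seq p.1 | p <- R] ++ [seq p.2 | p <- R]).
Proof.
apply/permP=> P; rewrite count_cat.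
by elim: R => //= p R; rewrite /rot_edges => IHR; rewrite /= IHR; lia.
Qed.

Lemma uniq_rot_edges R : uniq (rot_edges R) ->
  [/\ uniq [seq p.1 | p <- R], uniq [seq p.2 | p <- R]
    & forall e, e \in [seq p.1 | p <- R] -> e \notin [seq p.2 | p <- R]].
Proof.
rewrite (perm_uniq (perm_rot_edges R)) cat_uniq => /and3P[u1 /hasPn dis u2].
split=> // e e1; apply/negP => /dis /=; by rewrite e1.
Qed.

Lemma shift_nat (x y : {ffun E -> nat}) lam R :
  int_eq y (shift x lam R) <->
  forall e, y e + lam * (e \in [seq p.2 | p <- R]) = x e + lam * (e \in [seq p.1 | p <- R]).
Proof. by split=> h e; have := h e; rewrite /shift /chi; do 2!case: (e \in _) => /=; lia. Qed.

Lemma sum_mem_count (P : pred E) (s : seq E) : uniq s ->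
  \sum_e (if P e then (e \in s : nat) else 0) = count P s.
Proof.
move=> us; rewrite -sum1_count [RHS]big_mkcond [RHS]big_uniq //= [RHS]big_mkcond /=.
by apply: eq_bigr => e _; case: (e \in s); case: (P e).
Qed.

End RotationLists.

(** * Stable matchings, arcs of the rotation digraph, and shifts along cycles *)

Section StableMatchings.
Variables (W F E : finType) (ew : E -> W) (ef : E -> F) (b : E -> nat).
Variable C : (W + F)%type -> {ffun E -> nat} -> {ffun E -> nat}.
Hypothesis HC : choice_axioms ew ef b C.

Implicit Types (x y z : {ffun E -> nat}) (a c d e : E) (v : (W + F)%type).
Implicit Types (R : seq (E * E)) (u : bool * E).

Local Notation inB := (inB ew ef b).
Local Notation acceptable := (acceptable ew ef b C).
Local Notation interesting := (interesting ew ef b C).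
Local Notation stable := (stable ew ef b C).
Local Notation Uplus := (Uplus ew ef b C).
Local Notation Uminus := (Uminus ew ef b C).
Local Notation legal_fpair := (legal_fpair ew ef b C).
Local Notation essential_wpair := (essential_wpair ew ef b C).
Local Notation darc := (darc ew ef b C).
Local Notation res := (restr ew ef).
Local Notation top := (top ew ef b).

Definition UP x : pred E := fun e => `[< Uplus x e >].

Lemma UPP x e : reflect (Uplus x e) (UP x e).
Proof. exact: asboolP. Qed.

Lemma stable_acceptable x v : stable x -> acceptable v (res v x).
Proof. by case=> -[_ +] _; apply. Qed.

Lemma stable_inB x v : stable x -> inB v (res v x).
Proof. by move/stable_acceptable => /(_ v)[]. Qed.

Lemma incident_fE f e : incident ew ef (inr f) e -> f = ef e.
Proof. by move/eqP. Qed.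

Lemma incident_wE w e : incident ew ef (inl w) e -> w = ew e.
Proof. by move/eqP. Qed.

Lemma UP_uninteresting x w e : stable x -> UP x e ->
  ~ interesting (inl w) (res (inl w) x) e.
Proof.
move=> [_ nob] /UPP Ue int_e; apply: (nob e); split => //.
by rewrite -(incident_wE int_e.1).
Qed.

(** The order followed by a route, equality allowed. The last clause supplies the equal sizes that
    [exchange_convex] and [essential_convex] require. *)
Definition below x y :=
  [/\ forall w, C (inl w) (vmax (res (inl w) x) (res (inl w) y)) = res (inl w) x,
      forall f, C (inr f) (vmax (res (inr f) x) (res (inr f) y)) = res (inr f) y
    & forall v, vnorm (res v x) = vnorm (res v y)].

Lemma below_refl x : stable x -> below x x.
Proof.
move=> sx; split=> // [w|f]; rewrite vmaxxx.
  by have [] := stable_acceptable (inl w) sx.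
by have [] := stable_acceptable (inr f) sx.
Qed.

Lemma below_trans y x z : stable x -> stable y -> stable z ->
  below x y -> below y z -> below x z.
Proof.
move=> sx sy sz [wxy fxy nxy] [wyz fyz nyz]; split=> [w|f|v].
- rewrite vmaxC; apply: (choice_trans HC (y := res (inl w) y));
    try exact: stable_acceptable; by rewrite vmaxC.
- by apply: (choice_trans HC (y := res (inr f) y)); try exact: stable_acceptable.
- by rewrite nxy.
Qed.

Lemma below_Uplus x y e : stable x -> stable y -> below x y -> Uplus y e -> Uplus x e.
Proof.
move=> sx sy [_ fxy _]; apply: interesting_antimono => //; exact: stable_acceptable.
Qed.

Lemma below_lt_Uplus x y e : stable x -> stable y -> below x y -> x e < y e -> Uplus x e.
Proof.
move=> sx sy [_ fxy _] lt_e.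
apply: (interesting_of HC (inB_max (stable_inB _ sx) (stable_inB (inr (ef e)) sy))).
  exact: vle_maxl.
by rewrite fxy !ffunE /= eqxx.
Qed.

Lemma below_le x y e : stable x -> stable y -> below x y -> ~ Uplus x e -> y e <= x e.
Proof.
by move=> sx sy xy nU; rewrite leqNgt; apply/negP => /(below_lt_Uplus sx sy xy).
Qed.

(** Absence from U+ passes forward from [x]. Outside U+ the value at [e] cannot grow, so positivity
    passes backward from [z]. *)
Lemma below_Uminus x y z e : stable x -> stable y -> stable z ->
  below x y -> below y z -> Uminus x e -> Uminus z e -> Uminus y e.
Proof.
move=> sx sy sz xy yz [_ nxe] [ze _].
have nye : ~ Uplus y e by move/(below_Uplus sx sy xy).
by split=> //; exact: leq_trans ze (below_le sy sz yz nye).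
Qed.

(** An edge on which [f] chooses more than [y] has a larger value in [x]. Its end in W chooses [x]
    from the join, so the edge would block [y]. *)
Lemma polarity x y : stable x -> stable y ->
  (forall w, C (inl w) (vmax (res (inl w) x) (res (inl w) y)) = res (inl w) x) ->
  forall f, C (inr f) (vmax (res (inr f) x) (res (inr f) y)) = res (inr f) y.
Proof.
move=> sx sy wxy f; have [Bx _] := stable_acceptable (inr f) sx.
have [By yy] := stable_acceptable (inr f) sy.
have Bu := inB_max Bx By.
rewrite -[RHS]yy; apply/esym/(choice_consistent HC Bu); first exact: vle_maxr.
move=> e; rewrite leqNgt; apply/negP => lt_e.
have ie : incident ew ef (inr f) e.
  apply: (incident_pos Bu).
  exact: leq_trans (leq_ltn_trans (leq0n _) lt_e) (choice_le HC Bu e).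
have fe := incident_fE ie.
have lt_yx : y e < x e.
  have := leq_trans lt_e (choice_le HC Bu e).
  by rewrite !ffunE ie leq_max ltnn orbF.
case: (sy) => _ /(_ e); apply; split; last first.
  by rewrite -fe; apply: (interesting_of HC Bu) => //; exact: vle_maxr.
have Bw := inB_max (stable_inB (inl (ew e)) sx) (stable_inB (inl (ew e)) sy).
apply: (interesting_of HC Bw); first exact: vle_maxr.
by rewrite wxy !ffunE /= eqxx.
Qed.

Lemma legal_fpair_addunit x a c : legal_fpair x a c ->
  addunit (C (inr (ef a)) (addunit (res (inr (ef a)) x) a)) c =
  addunit (res (inr (ef a)) x) a.
Proof. by case=> _ [_ [_ /int_eq_plus_minus]]. Qed.

Lemma legal_fpair_functional x a c d : legal_fpair x a c -> legal_fpair x a d -> c = d.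
Proof.
move=> /legal_fpair_addunit Ec /legal_fpair_addunit Ed.
exact: addunit_inj (etrans Ec (esym Ed)).
Qed.

Lemma legal_fpair_convex x y z a c : gapless ew ef b C (inr (ef a)) ->
  stable x -> stable y -> stable z -> below x y -> below y z ->
  legal_fpair x a c -> legal_fpair z a c -> legal_fpair y a c.
Proof.
move=> gap sx sy sz xy yz lx lz; have [Ux [fc [ca _]]] := lx; have [Uz _] := lz.
split; first exact: below_Uplus yz Uz.
split=> //; split=> //; apply/int_eq_plus_minus.
case: xy => _ fxy _; case: yz => _ fyz nyz.
apply: (exchange_convex HC gap (stable_acceptable _ sx) (stable_acceptable _ sy)
          (stable_acceptable _ sz)) => //=; rewrite ?fc //.
- by have [] := interesting_addunit HC (stable_acceptable _ sx) Ux.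
- exact: legal_fpair_addunit.
- exact: legal_fpair_addunit.
Qed.

(** Essentiality as a value of the choice function; in this form [c] determines [a]. *)
Definition picks x c a :=
  C (inl (ew c)) (subunit (top (inl (ew c)) (res (inl (ew c)) x) (UP x)) c) =
  swap (res (inl (ew c)) x) a c.

(** Stability makes the edges of [UP x] uninteresting for W, which is what [choice_top_swapP] asks
    of [P]. *)
Lemma essentialP x c a : stable x ->
  essential_wpair x c a <->
  [/\ Uminus x c, Uplus x a, ew a = ew c & picks x c a].
Proof.
move=> sx; set w := ew c.
have ax := stable_acceptable (inl w) sx.
have noP := @UP_uninteresting x w _ sx.
have pre : Uminus x c -> Uplus x a -> ew a = w ->
    [/\ UP x a, ~~ UP x c, a != c & 0 < res (inl w) x c].
  move=> [xc nUc] Ua aw; have nPc : ~~ UP x c by apply/UPP.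
  have Pa : UP x a by apply/UPP.
  by split=> //; [apply: contraNneq nPc => <- | rewrite ffunE /= eqxx].
split=> [[Uc [Ua [aw [y [/int_eq_plus_minus Ey [ay no_d]]]]]]|[Uc Ua aw pk]].
  have [Pa Pc ac xc] := pre Uc Ua aw.
  have [{}Ey _] := addunit_eq_swap ac Ey; rewrite {y}Ey in ay no_d.
  split=> //; apply/(choice_top_swapP HC ax noP Pa Pc xc); split=> // d /UPP Ud da int_d.
  by apply: (no_d d) => //; rewrite -(incident_wE int_d.1).
have [Pa Pc ac xc] := pre Uc Ua aw.
have [as_ no_d] := (choice_top_swapP HC ax noP Pa Pc xc).1 pk.
split=> //; split=> //; split=> //; exists (swap (res (inl w) x) a c); split.
  by apply/int_eq_plus_minus; exact: swap_addunit.
by split=> // d /UPP Pd _ da; exact: no_d.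
Qed.

Lemma essential_functional x c a d : stable x ->
  essential_wpair x c a -> essential_wpair x c d -> a = d.
Proof.
move=> sx /(essentialP _ _ sx)[_ _ _ pa] /(essentialP _ _ sx)[_ _ _ pd].
exact: addunit_inj (etrans (esym pa) pd).
Qed.

(** For a vertex of W, [x] is best and [z] worst, and the sets [UP] shrink from [x] to [z], as
    [essential_convex] requires. *)
Lemma essential_wpair_convex x y z c a : gapless ew ef b C (inl (ew c)) ->
  stable x -> stable y -> stable z -> below x y -> below y z ->
  essential_wpair x c a -> essential_wpair z c a -> essential_wpair y c a.
Proof.
move=> gap sx sy sz xy yz /(essentialP _ _ sx)[Uxc Uxa aw px].
move=> /(essentialP _ _ sz)[Uzc Uza _ pz]; apply/(essentialP _ _ sy); split=> //.
- exact: below_Uminus xy yz Uxc Uzc.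
- exact: below_Uplus yz Uza.
have resP x' y' e : stable x' -> stable y' -> below x' y' ->
    res (inl (ew c)) x' e < res (inl (ew c)) y' e -> UP x' e.
  move=> sx' sy' xy'; rewrite !ffunE; case: ifP => // _ lt_e.
  by apply/UPP; exact: below_lt_Uplus xy' lt_e.
have subP x' y' : stable x' -> stable y' -> below x' y' -> subpred (UP y') (UP x').
  by move=> sx' sy' xy' e /UPP Ue; apply/UPP; exact: below_Uplus xy' Ue.
apply: (essential_convex HC gap (stable_acceptable _ sx) (stable_acceptable _ sy)
  (stable_acceptable _ sz) (P := UP x) (Q := UP y) (T := UP z)) => //=; rewrite ?aw ?eqxx //.
- by case: yz => _ _ ->.
- by move=> e; exact: UP_uninteresting.
- by move=> e; exact: UP_uninteresting.
- by move=> e; exact: UP_uninteresting.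
- exact: subP.
- exact: subP.
- by move=> e; exact: resP.
- by move=> e; exact: resP.
- by apply/UPP; case: Uxc.
- exact/UPP.
- by rewrite ffunE /= eqxx; case: Uzc.
Qed.

Lemma darc_convex x y z u u' : (forall v, gapless ew ef b C v) ->
  stable x -> stable y -> stable z -> below x y -> below y z ->
  darc x u u' -> darc z u u' -> darc y u u'.
Proof.
move=> gap sx sy sz xy yz [dux [du'x dx]] [duz [du'z dz]].
(* An edge may move from U+ to U- between [x] and [z]; at [y] either can hold. *)
have dv (e : bool * E) :
    dvertex ew ef b C x e -> dvertex ew ef b C z e -> dvertex ew ef b C y e.
  move=> dxe [Uz|Uz]; first by left; exact: below_Uplus yz Uz.
  case: dxe => [Ux|Ux]; last by right; exact: below_Uminus xy yz Ux Uz.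
  have [Uy|nUy] := EM (Uplus y e.2); first by left.
  by right; split=> //; exact: leq_trans Uz.1 (below_le sy sz yz nUy).
split; first exact: dv; split; first exact: dv.
case: u u' dx dz {dux du'x duz du'z} => [[] e] [[] e'] dx dz.
- exact: essential_wpair_convex xy yz dx dz.
- by case: dx dz => -> _ [_ Uz]; split=> //; exact: below_Uplus yz Uz.
- by case: dx dz => -> Ux [_ Uz]; split=> //; exact: below_Uminus xy yz Ux Uz.
- exact: legal_fpair_convex xy yz dx dz.
Qed.

(** The arcs of a rotation grouped by pairs, the form in which they are carried from one time to
    another. *)
Definition good x R :=
  (forall p, p \in R -> [/\ Uplus x p.1, legal_fpair x p.1 p.2 & Uminus x p.2]) /\
  (forall p q, (p, q) \in arcs R -> essential_wpair x p.2 q.1).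

Lemma good_of_darcs x R :
  (forall u u', (u, u') \in arcs (rot_vertices R) -> darc x u u') -> good x R.
Proof.
move/rot_vertices_arcs => [h1 h2]; split=> [p /h1|p q /h2]; last by case=> _ [_ ?].
by case=> [[_ [_ [_ ?]]] [_ [_ ?]] [_ [_ [_ ?]]]].
Qed.

(** At a vertex of F the two members of a pair cancel. At a vertex of W each leaving edge cancels
    against the entering edge of the next pair, hence the turn of the list by one. *)
Lemma count_plus_minus x R v : good x R ->
  count (incident ew ef v) [seq p.1 | p <- R] = count (incident ew ef v) [seq p.2 | p <- R].
Proof.
move=> [g1 g2]; rewrite !count_map; case: v => [w|f]; last first.
  by apply: eq_in_count => p /g1[_ [_ [fp _]] _] /=; rewrite fp.
rewrite -(permP (permEl (perm_rot 1 R))) -{1}unzip2_arcs -{2}(unzip1_arcs R) !count_map.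
by apply: eq_in_count => -[p q] /g2[_ [_ [wq _]]] /=; rewrite wq.
Qed.

Lemma vnorm_shift x y lam R v : good x R -> uniq (rot_edges R) ->
  int_eq y (shift x lam R) -> vnorm (res v y) = vnorm (res v x).
Proof.
move=> gR /uniq_rot_edges[u1 u2 _] /shift_nat xy.
have split_sum (z : {ffun E -> nat}) s : uniq s ->
    \sum_e (if incident ew ef v e then z e + lam * (e \in s) else 0) =
    vnorm (res v z) + lam * count (incident ew ef v) s.
  move=> us; rewrite -sum_mem_count // big_distrr -big_split /=.
  by apply: eq_bigr => e _; rewrite ffunE; case: ifP; rewrite ?muln0.
have := split_sum y _ u2; rewrite -(count_plus_minus v gR) => Ey.
have := split_sum x _ u1 => Ex.
apply/(@addIn (lam * count (incident ew ef v) [seq p.1 | p <- R])).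
rewrite -Ey -Ex; apply: eq_bigr => e _; by rewrite xy.
Qed.

Lemma shift_below x y lam R : stable x -> stable y -> good x R ->
  uniq (rot_edges R) -> int_eq y (shift x lam R) -> below x y.
Proof.
move=> sx sy gR uR xy.
have wxy w : C (inl w) (vmax (res (inl w) x) (res (inl w) y)) = res (inl w) x.
  apply: (absorb_uninteresting HC (stable_acceptable _ sx)).
  - exact: inB_max (stable_inB _ sx) (stable_inB _ sy).
  - exact: vle_maxl.
  move=> e; rewrite !ffunE leq_max ltnn /=; case: ifP => // _ lt_e.
  apply: UP_uninteresting => //; apply/UPP.
  have : e \in [seq p.1 | p <- R].
    have /shift_nat/(_ e) := xy; case: (e \in [seq p.1 | p <- R]) => //; lia.
  by case/mapP=> p /gR.1[Up _ _] ->.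
split=> //; first exact: polarity.
by move=> v; rewrite (vnorm_shift v gR uR xy).
Qed.

(** The new vector is a choice at every vertex: at [f] from [x] with all entering edges added, at
    [w] from the offer [top] with all leaving edges lowered. The latter choice also shows that no
    edge of U+ tempts [w], which excludes blocking. *)
Lemma shift_stable x R : stable x -> good x R -> uniq (rot_edges R) ->
  exists y, int_eq y (shift x 1 R) /\ stable y.
Proof.
move=> sx gR uR; have [u1 u2 disj] := uniq_rot_edges uR.
set A := [seq p.1 | p <- R] in u1 disj; set D := [seq p.2 | p <- R] in u2 disj.
have AU e : e \in A -> UP x e by case/mapP=> p /gR.1[Up _ _] ->; apply/UPP.
have DU e : e \in D -> ~~ UP x e by case/mapP=> p /gR.1[_ _ [_ nU]] ->; apply/UPP.
have Dpos e : e \in D -> 0 < x e by case/mapP=> p /gR.1[_ _ []] + _ ->.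
pose y : {ffun E -> nat} := [ffun e => x e + (e \in A) - (e \in D)].
have Ey : int_eq y (shift x 1 R).
  apply/shift_nat => e; rewrite !mul1n -/A -/D ffunE subnK //.
  by case: (boolP (e \in D)) => // /Dpos xe; exact: leq_trans xe (leq_addr _ _).
have ny v := vnorm_shift v gR uR Ey.
pose up f : {ffun E -> nat} :=
  [ffun e => res (inr f) x e + (incident ew ef (inr f) e && (e \in A))].
have Bup f : inB (inr f) (up f).
  move=> e; rewrite !ffunE; have := stable_inB (inr f) sx e; rewrite !ffunE.
  case: ifP => // ie; rewrite andTb; case: (boolP (e \in A)) => [|_]; last by rewrite addn0.
  move=> /AU/UPP Ue _; have [Be _] := interesting_addunit HC (stable_acceptable _ sx) Ue.
  by have := Be e; rewrite !ffunE /= !eqxx.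
(* (A2) against each single legal exchange bounds the choice by [y]; (A3) and equal sizes give
   equality. *)
have Cup f : C (inr f) (up f) = res (inr f) y.
  apply: vle_norm_eq; last first.
    rewrite ny; have [_ {1}<-] := stable_acceptable (inr f) sx.
    by apply: (choice_mono HC (Bup f)) => e; rewrite [up f e]ffunE leq_addr.
  move=> e; have := choice_le HC (Bup f) e.
  rewrite [up f e]ffunE !ffunE; case: (boolP (incident ew ef (inr f) e)) => //= ie.
  case: (boolP (e \in D)) => [eD|_]; last by rewrite subn0.
  have eA : e \notin A by apply/negP => /disj; rewrite eD.
  case/mapP: (eD) => p pR ep _; have [Up lp _] := gR.1 _ pR.
  have [_ [fp [cp _]]] := lp.
  have ff : f = ef p.1 by rewrite (incident_fE ie) ep.
  have le_up : vle (addunit (res (inr f) x) p.1) (up f).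
    move=> d; rewrite [up f d]ffunE ffunE leq_add2l; case: (eqVneq d p.1) => // ->.
    have -> : p.1 \in A by apply/mapP; exists p.
    by rewrite ff /= eqxx.
  have := choice_subst HC e (Bup f) le_up.
  have := congr1 (fun z : {ffun E -> nat} => z e) (legal_fpair_addunit lp).
  have rx : res (inr f) x e = x e by rewrite ffunE /= ie.
  have ep1 : (e == p.1) = false by rewrite ep (negbTE cp).
  have ep2 : (e == p.2) = true by rewrite ep eqxx.
  rewrite -ff ![addunit _ _ e]ffunE rx ep1 ep2 (negbTE eA); have := Dpos _ eD.
  by clear; lia.
pose dn w : {ffun E -> nat} := [ffun e => top (inl w) (res (inl w) x) (UP x) e - (e \in D)].
have Btop w := inB_top (UP x) (stable_inB (inl w) sx).
have le_top w e : res (inl w) x e <= top (inl w) (res (inl w) x) (UP x) e.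
  exact: vle_top (stable_inB _ sx) _.
have Ctop w := choice_top HC (stable_acceptable (inl w) sx)
                 (fun e => @UP_uninteresting x w e sx).
have le_dn w : vle (dn w) (top (inl w) (res (inl w) x) (UP x)).
  by move=> e; rewrite ffunE leq_subr.
have Bdn w := inB_le (Btop w) (le_dn w).
(* Dually, (A2) against [top] and against each single essential exchange bounds the choice from
   below by [y], and (A3) against [top] bounds its size. *)
have Cdn w : C (inl w) (dn w) = res (inl w) y.
  apply/esym/vle_norm_eq; last first.
    by rewrite ny -[in X in _ <= X](Ctop w); apply: (choice_mono HC).
  move=> e; rewrite ffunE; case: ifP => // ie; rewrite ffunE.
  have sub := choice_subst HC e (Btop w) (le_dn w).
  have resx : res (inl w) x e = x e by rewrite ffunE ie.
  rewrite Ctop [dn w e]ffunE resx in sub.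
  have := le_top w e; rewrite resx => lt.
  case: (boolP (e \in A)) => [eA|_]; last first.
    by move: sub lt; clear; lia.
  have /negbTE eD := disj _ eA; rewrite eD in sub *.
  (* The preceding pair in the cycle supplies the edge whose release makes [w] take [e]. *)
  case/mapP: eA => q /arcs_pred[p pq] eq.
  have [Up Uq wq pk] := (essentialP _ _ sx).1 (gR.2 _ _ pq).
  have wp : w = ew p.2 by rewrite -wq (incident_wE ie) eq.
  have pD : p.2 \in D by apply/mapP; exists p => //; have /andP[] := arcs_mem pq.
  rewrite /picks -wp in pk.
  have le_sub : vle (dn w) (subunit (top (inl w) (res (inl w) x) (UP x)) p.2).
    move=> d; rewrite [dn w d]ffunE [subunit _ _ d]ffunE; apply: leq_sub2l.
    by case: eqP => // ->; rewrite pD.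
  have Bsub := inB_le (Btop w) (subunit_le (top (inl w) (res (inl w) x) (UP x)) p.2).
  have := choice_subst HC e Bsub le_sub; have := choice_le HC Bsub e.
  have /negbTE ep : e != p.2 by apply: contraFneq eD => ->.
  rewrite pk [dn w e]ffunE eD [swap _ _ _ _]ffunE ![subunit _ _ e]ffunE ep resx eq eqxx.
  by clear; lia.
have acc v : acceptable v (res v y).
  by case: v => [w|f]; rewrite -?Cdn -?Cup; exact: choice_acceptable.
exists y; split=> //; split.
  split=> // e; have [/(_ e)] := acc (inr (ef e)).
  by rewrite ffunE /= eqxx.
move=> e [iw if_].
(* The end in F weakly prefers [y] to [x], so its interest in [e] under [y] was already there under
   [x]. *)
have Ue : Uplus x e.
  apply: (interesting_antimono HC (stable_acceptable _ sx) (acc _)) if_.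
  apply: (choice_between HC (Bup _) (Cup _) (vle_maxr _ _)); apply: vmax_le => d.
    by rewrite [up _ d]ffunE leq_addr.
  by rewrite -Cup; exact: choice_le.
(* Raising [e] stays within the offer [dn], from which [w] already chose [y]. *)
case: iw => _ [t [Bt [lt_t [t_out]]]].
rewrite (choice_between HC (Bdn _) (Cdn _)) ?ltnn // => d.
  by case: (eqVneq d e) => [->|/t_out->] //; exact: ltnW.
case: (eqVneq d e) => [->|/t_out->]; last by rewrite -Cdn; exact: choice_le.
have /negbTE eD : e \notin D by apply/negP => /DU/UPP.
by rewrite [dn _ e]ffunE eD subn0 [top _ _ _ _]ffunE; have /UPP-> := Ue.
Qed.

End StableMatchings.

(* The witness is the p that becomes legal last. *)
Lemma latest_legal (T : eqType) (legal : T -> nat -> Prop) (s : seq T) j :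
  s <> [::] -> (forall p, p \in s -> legal p j) ->
  (forall p i k, p \in s -> i <= k <= j -> legal p i -> legal p j -> legal p k) ->
  exists2 p, p \in s &
    forall i, i < j -> legal p i -> forall q, q \in s -> legal q i.
Proof.
case: s => // p s _; elim: s p => [|q s IHs] p at_j conv.
  by exists p; rewrite ?mem_head // => i _ pi q; rewrite inE => /eqP->.
have [p' p's late] : exists2 p', p' \in q :: s &
    forall i, i < j -> legal p' i -> forall q', q' \in q :: s -> legal q' i.
  apply: IHs => [r rs|r i k rs]; first by apply: at_j; rewrite inE rs orbT.
  by apply: conv; rewrite inE rs orbT.
have p'ps : p' \in p :: q :: s by rewrite inE p's orbT.
have [pp'|/existsNP[k0 /not_implyP[k0j /not_implyP[pk0 np'k0]]]] :=
    EM (forall i, i < j -> legal p i -> legal p' i).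
  exists p; first exact: mem_head.
  move=> i ij pi r; rewrite inE => /predU1P[->//|rs].
  by apply: late rs => //; exact: pp'.
(* At [k0], [p] is legal and [p'] is not. Before [j], [p'] is thus legal only after [k0], where [p]
   is legal too by convexity. *)
exists p' => // i ij p'i r; rewrite inE => /predU1P[->|rs]; last exact: late rs.
have lt_k0i : k0 < i.
  rewrite ltnNge; apply/negP => le_i; apply: np'k0.
  by apply: conv p'i (at_j _ p'ps) => //; rewrite le_i ltnW.
apply: (conv _ k0 _ (mem_head _ _)) pk0 (at_j _ (mem_head _ _)).
by rewrite (ltnW lt_k0i) (ltnW ij).
Qed.

(** * Routes: repetition of rotations and length *)

Section Routes.
Variables (W F E : finType) (ew : E -> W) (ef : E -> F) (b : E -> nat).
Variable C : (W + F)%type -> {ffun E -> nat} -> {ffun E -> nat}.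
Hypothesis HC : choice_axioms ew ef b C.
Hypothesis Hgap : forall v, gapless ew ef b C v.

Implicit Types (x y z : {ffun E -> nat}) (R : seq (E * E)) (u : bool * E).

Local Notation stable := (stable ew ef b C).
Local Notation below := (below ew ef C).
Local Notation good := (good ew ef b C).
Local Notation darc := (darc ew ef b C).

Lemma good_rot n x R : good x (rot n R) -> good x R.
Proof.
case=> g1 g2; split=> [p pR|p q pq]; first by apply: g1; rewrite mem_rot.
by apply: g2; rewrite mem_arcs_rot.
Qed.

Lemma good_convex x y z R : stable x -> stable y -> stable z ->
  below x y -> below y z -> good x R -> good z R -> good y R.
Proof.
move=> sx sy sz xy yz [x1 x2] [z1 z2]; split=> [p pR|p q pq].
  have [Ux lx nx] := x1 _ pR; have [Uz lz nz] := z1 _ pR; split.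
  - exact: below_Uplus yz Uz.
  - exact: legal_fpair_convex xy yz lx lz.
  - exact: below_Uminus xy yz nx nz.
exact: essential_wpair_convex xy yz (x2 _ _ pq) (z2 _ _ pq).
Qed.

(** Since U+ and U- are disjoint, a shared edge has the same role in both lists. A shared entering
    edge determines its partner, and a shared leaving edge determines the next entering edge. *)
Lemma good_share x R R' u : stable x -> good x R -> good x R' ->
  u \in rot_vertices R -> u \in rot_vertices R' ->
  exists p, (p \in R) && (p \in R').
Proof.
move=> sx [g1 g2] [g1' g2'].
have edge R0 : u \in rot_vertices R0 -> exists2 p, p \in R0 & (u.2 = p.1) \/ (u.2 = p.2).
  case/flattenP=> s /mapP[p pR ->]; rewrite !inE => h; exists p => //.
  by case/or4P: h => /eqP->; [left | left | right | right].
move=> /edge[p pR up] /edge[p' pR' up'].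
have fst_eq q q' : q \in R -> q' \in R' -> q.1 = q'.1 -> exists p, (p \in R) && (p \in R').
  move=> qR qR' qq; exists q; rewrite qR; suff -> : q = q' by [].
  have [_ l _] := g1 _ qR; have [_ l' _] := g1' _ qR'; rewrite -qq in l'.
  by case: q q' qq l l' {qR qR'} => [a c] [a' c'] /= -> l /(legal_fpair_functional l) ->.
have [Up _ [_ nUp]] := g1 _ pR; have [Up' _ [_ nUp']] := g1' _ pR'.
case: up up' => [->|->] [].
- exact: fst_eq.
- by move=> pp; rewrite pp in Up.
- by move=> pp; rewrite pp in nUp.
move=> pp; have [q pq] := arcs_succ pR; have [q' pq'] := arcs_succ pR'.
have := g2' _ _ pq'; rewrite -pp => /(essential_functional HC sx (g2 _ _ pq)).
by apply: fst_eq; [have /andP[] := arcs_mem pq | have /andP[] := arcs_mem pq'].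
Qed.

(** Consecutive pairs are linked by an essential pair followed by a legal pair. This relation is
    functional, so one shared pair determines the whole cycle. *)
Lemma good_same_rot x R R' u : stable x -> good x R -> good x R' ->
  uniq (rot_edges R) -> uniq (rot_edges R') ->
  u \in rot_vertices R -> u \in rot_vertices R' -> same_rot R R'.
Proof.
move=> sx gR gR' /uniq_rot_edges[/map_uniq uR _ _] /uniq_rot_edges[/map_uniq uR' _ _] uu uu'.
have [p /andP[pR pR']] := good_share sx gR gR' uu uu'.
pose r (p q : E * E) := essential_wpair ew ef b C x p.2 q.1 /\ legal_fpair ew ef b C x q.1 q.2.
have good_r R0 : good x R0 -> forall p q, (p, q) \in arcs R0 -> r p q.
  move=> [g1 g2] p0 q pq; split; first exact: g2.
  by have /andP[_ /g1[]] := arcs_mem pq.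
apply: (cycle_functional (r := r)) pR pR' => //; try exact: good_r.
move=> p0 [a c] [a' c'] [/= e l] [/= e' l'].
have aa := essential_functional HC sx e e'; rewrite aa in l *.
by rewrite (legal_fpair_functional l l').
Qed.

(** Arcs staying on one side change the edge, crossing arcs keep it; so the two edges and the side
    of the tail reveal the side of the head. *)
Lemma darc_head x u u' : darc x u u' ->
  (if u.1 then ew u'.2 = ew u.2 else ef u'.2 = ef u.2) /\
  u'.1 = (if u.1 then u'.2 != u.2 else u'.2 == u.2).
Proof.
case: u u' => [[] e] [[] e'] [_ [_ /=]].
- move=> [[_ nU] [U [-> _]]]; split=> //; apply/esym/eqP => ee.
  by rewrite ee in U.
- by move=> [-> _]; rewrite eqxx.
- by move=> [-> _]; rewrite eqxx.
- by move=> [_ [-> [/negbTE-> _]]].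
Qed.

(** The two edges of an arc share the end on the side of its tail, so the opposite end of the head
    edge identifies it. This leaves |E||W| + |E||F| codes. *)
Definition arc_code (p : (bool * E) * (bool * E)) : E * W + E * F :=
  if p.1.1 then inr (p.1.2, ef p.2.2) else inl (p.1.2, ew p.2.2).

Lemma arc_code_inj x y u1 u2 u1' u2' : injective (fun e => (ew e, ef e)) ->
  darc x u1 u2 -> darc y u1' u2' -> arc_code (u1, u2) = arc_code (u1', u2') ->
  (u1, u2) = (u1', u2').
Proof.
move=> simple /darc_head + /darc_head; rewrite /arc_code.
case: u1 u2 u1' u2' => [[] e1] [b2 e2] [[] e1'] [b2' e2'] //= [E1 ->] [E2 ->] [ee xx].
  by rewrite -ee in E2 *; rewrite (simple e2 e2') // E1 E2 xx.
by rewrite -ee in E2 *; rewrite (simple e2 e2') // E1 E2 xx.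
Qed.

Variables (N : nat) (xs : nat -> {ffun E -> nat}) (Rs : nat -> seq (E * E)).
Variable lams : nat -> nat.
Hypothesis Hroute : route ew ef b C N xs Rs lams.

Lemma route_stable i : i < N -> stable (xs i).
Proof. by case: Hroute => + _; apply. Qed.

Lemma route_step i : i.+1 < N ->
  [/\ good (xs i) (Rs i), uniq (rot_edges (Rs i)), feasible ew ef b C (xs i) (Rs i) (lams i)
    & int_eq (xs i.+1) (shift (xs i) (lams i) (Rs i))].
Proof.
case: Hroute => _ /(_ i) h /h[[_ [_ [uR [_ dR]]]] [fe Ei]]; split=> //.
exact: good_of_darcs dR.
Qed.

Lemma route_below i j : i <= j -> j < N -> below (xs i) (xs j).
Proof.
move=> + jN; elim: j jN => [|j IHj] jN.
  by rewrite leqn0 => /eqP->; apply: below_refl; exact: route_stable.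
rewrite leq_eqVlt => /predU1P[->|]; first by apply: below_refl; exact: route_stable.
rewrite ltnS => ij; have jN' := ltnW jN.
have [gR uR _ Ej] := route_step jN.
have sj := route_stable jN'; have sj1 := route_stable jN.
apply: (below_trans HC (route_stable (leq_ltn_trans ij jN')) sj sj1 (IHj jN' ij)).
exact: (shift_below HC sj sj1 gR uR Ej).
Qed.

Lemma rotation_once i j : non_excessive ew ef b C N xs Rs lams ->
  i < j -> j.+1 < N -> ~ same_rot (Rs i) (Rs j).
Proof.
move=> Hne ij jN same; have [[_ feas] tau] := Hne _ _ ij jN same.
have iN : i.+1 < N := leq_ltn_trans ij (ltnW jN).
have [gi ui _ Ei] := route_step iN; have [gj _ _ _] := route_step jN.
have gj' : good (xs j) (Rs i) by case: same => n En; apply: (@good_rot n); rewrite En.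
have si := route_stable (ltnW iN); have si1 := route_stable iN.
have gi1 : good (xs i.+1) (Rs i).
  apply: (good_convex si si1 (route_stable (ltnW jN))) gi gj'.
    exact: route_below (leqnSn i) iN.
  exact: route_below ij (ltnW jN).
have [y [Ey sy]] := shift_stable HC si1 gi1 ui.
(* Only the weight [(lams i).+1] is new, and it amounts to one more unit shift from [xs i.+1]. *)
suff /tau : feasible ew ef b C (xs i) (Rs i) (lams i).+1 by rewrite ltnn.
split=> // k /andP[k1]; rewrite leq_eqVlt => /predU1P[->|kl]; last by apply: feas; rewrite k1.
exists y; split=> //; apply/shift_nat => e.
have /shift_nat/(_ e) := Ei; have /shift_nat/(_ e) := Ey.
by do 2!case: (e \in _); rewrite ?muln1 ?muln0; clear; lia.
Qed.

Lemma latest_arc j : j.+1 < N -> exists p,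
  [/\ p \in arcs (rot_vertices (Rs j)), darc (xs j) p.1 p.2
    & forall i, i < j -> darc (xs i) p.1 p.2 -> good (xs i) (Rs j)].
Proof.
move=> jN; have jN' := ltnW jN; case: Hroute => _ /(_ j jN)[[R0 [_ [_ [_ dR]]]] _].
have at_j p : p \in arcs (rot_vertices (Rs j)) -> darc (xs j) p.1 p.2.
  by case: p => u u' uu'; exact: dR.
have [||p i k pR /andP[ik kj] pi pj|p pR late] :=
    @latest_legal _ (fun p i => darc (xs i) p.1 p.2) (arcs (rot_vertices (Rs j))) j.
- case: (Rs j) R0 => // q R _; rewrite /arcs [rot_vertices _]/= rot1_cons; by [].
- exact: at_j.
- have kN := leq_ltn_trans kj jN'; have iN := leq_ltn_trans ik kN.
  exact: (darc_convex HC Hgap (route_stable iN) (route_stable kN) (route_stable jN')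
    (route_below ik kN) (route_below kj jN')).
exists p; split=> // [|i ij pi]; first exact: at_j.
by apply: good_of_darcs => u u' uu'; exact: (late i ij pi (u, u')).
Qed.

Lemma route_length : injective (fun e => (ew e, ef e)) ->
  (forall i j, i < j -> j.+1 < N -> ~ same_rot (Rs i) (Rs j)) ->
  N.-1 <= #|E| * #|W| + #|E| * #|F|.
Proof.
move=> simple once.
(* The [N] matchings are joined by [N.-1] steps, which index the injection into arc codes. *)
have lt_N (j : 'I_N.-1) : j.+1 < N by case: j => j /=; lia.
have /fin_all_exists[f fP] j := latest_arc (lt_N j).
have head j : (f j).1 \in rot_vertices (Rs j).
  have [+ _ _] := fP j; case: (f j) => u u' /arcs_mem/andP[]; by [].
have inj : injective (fun j => arc_code (f j)).
  have no_lt (i j : 'I_N.-1) : i < j -> arc_code (f i) <> arc_code (f j).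
    move=> ij code; have [_ di _] := fP i; have [_ dj late] := fP j.
    have fij : f i = f j.
      move: code di dj; case: (f i) (f j) => [u1 u2] [u1' u2'] code di dj.
      exact: arc_code_inj di dj code.
    rewrite fij in di; have := late _ ij di => gj.
    have [gi ui _ _] := route_step (lt_N i); have [_ uj _ _] := route_step (lt_N j).
    apply: (once i j ij (lt_N j)).
    apply: (good_same_rot (route_stable (ltnW (lt_N i))) gi gj ui uj (head i)).
    by rewrite fij.
  move=> i j code; apply/val_inj.
  by case: (ltngtP (val i) (val j)) => // /no_lt; [case | case; exact: esym].
by have := leq_card _ inj; rewrite card_ord card_sum !card_prod.
Qed.

End Routes.

Theorem theorem7p1 (W F E : finType) (ew : E -> W) (ef : E -> F)
  (Hsimple : injective (fun e => (ew e, ef e)))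
  (HEne : 0 < #|E|)
  (b : E -> nat) (C : (W + F)%type -> {ffun E -> nat} -> {ffun E -> nat})
  (HC : choice_axioms ew ef b C)
  (Hgap : forall v, gapless ew ef b C v)
  (N : nat) (xs : nat -> {ffun E -> nat}) (Rs : nat -> seq (E * E))
  (lams : nat -> nat)
  (Hroute : route ew ef b C N xs Rs lams)
  (Hne : non_excessive ew ef b C N xs Rs lams) :
  (forall i j, i < j -> j.+1 < N -> ~ same_rot (Rs i) (Rs j)) /\
  N < 4 * #|E| ^ 2 * #|F| * #|W|.
Proof.
have once i j := rotation_once HC Hgap Hroute (i := i) (j := j) Hne.
split=> //; have := route_length HC Hgap Hroute Hsimple once.
(* An edge makes all three cardinalities positive. Then |W| + |F| is at most 2|F||W|, so [N] is at
   most 1 + 2|E||F||W|, below the claimed bound. *)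
have /card_gt0P[e _] := HEne.
have : 0 < #|W| by apply/card_gt0P; exists (ew e).
have : 0 < #|F| by apply/card_gt0P; exists (ef e).
move: HEne; move: #|E| #|F| #|W| => n q p; clear.
case: n q p => // n [//|q] [//|p] _ _ _; rewrite -mulnn; nia.
Qed.
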